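(* Let $A$ be a primorial whose largest prime factor is $P_N$, and let $P_Z$ be the smallest non-core seed prime of $A$. Then the potential primes under $A$ (and hence the members of any subset of the set of potential primes under $A$) that are less than $P_Z^2$ are not converted to composites: they are prime numbers.
   Context: A primorial is a product $P\# = 2\cdot 3\cdot 5\cdots P$ of all primes up to some prime $P$. The seed primes of a primorial $A$ are the primes $\le \sqrt{A}$. For a primorial $A>30$ the core seed primes of $A$ are the primes less than or equal to the largest prime factor of $A$ (i.e. the prime factors of $A$), and the non-core seed primes of $A$ are the remaining seed primes, i.e. the primes $p$ with $p$ greater than the largest prime factor of $A$ and $p\le\sqrt{A}$. A potential prime under a primorial $A$ is a positive odd integer $M<A$ such that $M \bmod p \neq 0$ for every core seed prime $p$ of $A$. A potential prime is ''converted to a composite'' if it is divisible by a non-core seed prime of $A$ and is composite.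
   Formalization: The number 1 is a potential prime under the given definition and is less than P_Z^2 but is not prime, so primality is asserted only for potential primes other than 1; that they are not converted to composites is asserted for all. *)

(* Defs.v *)
From mathcomp Require Import all_boot.

Set Implicit Arguments.
Unset Strict Implicit.
Unset Printing Implicit Defensive.

Definition primorial (P : nat) : nat := \prod_(p < P.+1 | prime p) p.

Definition is_primorial (A : nat) : Prop :=
  exists2 P : nat, prime P & A = primorial P.

(* [p ^ 2 <= A] is [p <= sqrt A] with the exact real square root. *)
Definition seed_prime (A : nat) : pred nat :=
  [pred p | prime p & p ^ 2 <= A].

(* The classification into core and non-core seed primes is intended for
   primorials [A > 30]; for those the core primes are indeed seed primes. *)
Definition core_seed_prime (A : nat) : pred nat :=
  [pred p | prime p & p <= max_pdiv A].

Definition noncore_seed_prime (A : nat) : pred nat :=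
  [pred p | seed_prime A p & max_pdiv A < p].

Definition smallest_noncore_seed_prime (A p : nat) : Prop :=
  noncore_seed_prime A p /\
  (forall q : nat, noncore_seed_prime A q -> p <= q).

(* Taken literally: in particular [1] is a potential prime. *)
Definition potential_prime (A M : nat) : Prop :=
  [/\ 0 < M, odd M, M < A
    & forall p : nat, core_seed_prime A p -> M %% p <> 0].

Definition composite (M : nat) : bool := (1 < M) && ~~ prime M.

Definition converted_to_composite (A M : nat) : Prop :=
  (exists2 q : nat, noncore_seed_prime A q & q %| M) /\ composite M.

(* Main.v *)
(* The least prime factor p of a composite potential prime M satisfies
   p ^ 2 <= M < A, so p is a seed prime; it is not core, hence P_Z <= p and
   P_Z ^ 2 <= M. *)
Require Import Defs.
From mathcomp Require Import all_boot.

(** A number [M > 1] below the square of its least prime factor is prime. If instead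
    [pdiv M ^ 2 <= M < A], then [pdiv M], which cannot be core, is a non-core seed prime, so
    [P_Z <= pdiv M] and [P_Z ^ 2 <= M], a contradiction. The value 1 is set apart, being neither
    prime nor composite. *)

Lemma potential_prime_prime (A P_Z M : nat) :
  smallest_noncore_seed_prime A P_Z -> potential_prime A M ->
  M < P_Z ^ 2 -> M <> 1 -> prime M.
Proof.
move=> [_ minPZ] [M_gt0 _ ltMA ncoreM] ltMPZ /eqP M_neq1.
have pr_p : prime (pdiv M) by rewrite pdiv_prime // ltn_neqAle eq_sym M_neq1.
apply: ltn_pdiv2_prime => //; rewrite ltnNge; apply/negP => le_p2M.
have [le_pA | lt_Ap] := leqP (pdiv M) (max_pdiv A).
  have core_p : core_seed_prime A (pdiv M) by apply/andP.
  by apply: (ncoreM _ core_p); apply/eqP; apply: pdiv_dvd.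
have /minPZ le_PZp : noncore_seed_prime A (pdiv M).
  by apply/andP; split=> //; apply/andP; split=> //; apply: leq_trans (ltnW ltMA).
by move: ltMPZ; rewrite ltnNge (leq_trans _ le_p2M) // leq_sqr.
Qed.

Theorem theorem5 (A P_N P_Z : nat)
    (hA : is_primorial A) (hA30 : 30 < A)
    (hPN : P_N = max_pdiv A)
    (hPZ : smallest_noncore_seed_prime A P_Z) :
  (forall M : nat, potential_prime A M -> M < P_Z ^ 2 ->
     ~ converted_to_composite A M /\ (M <> 1 -> prime M)) /\
  (forall S : nat -> Prop, (forall M : nat, S M -> potential_prime A M) ->
     forall M : nat, S M -> M < P_Z ^ 2 ->
     ~ converted_to_composite A M /\ (M <> 1 -> prime M)).
Proof.
have key M : potential_prime A M -> M < P_Z ^ 2 ->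
    ~ converted_to_composite A M /\ (M <> 1 -> prime M).
  move=> potM ltM; have prM := potential_prime_prime _ _ _ hPZ potM ltM.
  (* Compositeness carries [1 < M], which excludes the exceptional value 1. *)
  split=> // -[_ /andP[M_gt1 /negP]]; apply; apply: prM => M1.
  by rewrite M1 in M_gt1.
by split=> // S potS M SM; apply/key/potS.
Qed.
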